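(* Let $X$ be a Hausdorff topological vector space, let $f:X\to\,]-\infty,\infty]$, let $D\subset \mathrm{dom} f$ and $u_0\in D$. Assume that $D$ is strongly star-shaped relative to $u_0$, that $f$ is ru-usc in $D$ relative to $u_0$, and that $\inf_D f>-\infty$. Then: (i) if $\overline{f+\chi_D}=f$ on $D$, then $\overline{f+\chi_D}=\widehat{f}_{u_0}+\chi_{\overline{D}}$ on $X$; (ii) $\widehat{f}_{u_0}(u)=\lim_{t\uparrow 1}f(tu+(1-t)u_0)$ for all $u\in\overline{D}$, and $\widehat{f}_{u_0}$ is ru-usc in $\overline{D}\cap \mathrm{dom}\,\widehat{f}_{u_0}$ relative to $u_0$.
   Context: $X$ is a real Hausdorff topological vector space. For $f:X\to[-\infty,\infty]$, $\mathrm{dom} f:=\{u\in X: f(u)<\infty\}$. Ru-usc: for $a>0$, $D\subset\mathrm{dom} f$, $u_0\in D$ and $t\in[0,1]$ put $\Delta^a_{f,D,u_0}(t):=\sup_{u\in D}\frac{f(tu+(1-t)u_0)-f(u)}{a+|f(u)|}\in\,]-\infty,\infty]$. The function $f$ is radially uniformly upper semicontinuous (ru-usc) in $D$ relative to $u_0$ if there exists $a>0$ such that $\limsup_{t\to1}\Delta^a_{f,D,u_0}(t)\le 0$. The same definition is used for $\widehat f_{u_0}$, which is $>-\infty$ on $\overline D$ in this setting. Strongly star-shaped: $D\subset X$ is strongly star-shaped relative to $u_0\in D$ if $t\overline{D}+(1-t)u_0\subset D$ for all $t\in[0,1[$, where $\overline D$ is the closure of $D$ in $X$. $\chi_D$ is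 the function equal to $0$ on $D$ and $\infty$ on $X\setminus D$. $\overline{f}$ denotes the lower semicontinuous envelope: $\overline f(u)=\sup_{U\in\mathcal V(u)}\inf_{v\in U}f(v)$, where $\mathcal V(u)$ is the set of neighborhoods of $u$. Radial extension: for $u_0\in\mathrm{dom} f$, $\widehat f_{u_0}:X\to[-\infty,\infty]$ is $\widehat f_{u_0}(u):=\liminf_{t\uparrow1}f(tu+(1-t)u_0)$, i.e. the infimum of $\liminf_{n\to\infty}f(t_nu+(1-t_n)u_0)$ over sequences $t_n\in[0,1[$ with $t_n\to1$. Convention: $(-\infty)+\infty=\infty$, so that $\widehat f_{u_0}+\chi_{\overline D}=\infty$ outside $\overline D$. *)

(* Defs.v *)
From HB Require Import structures.
From mathcomp Require Import all_boot all_order all_algebra.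
From mathcomp Require Import all_classical all_reals all_analysis.

Set Implicit Arguments.
Unset Strict Implicit.
Unset Printing Implicit Defensive.

Import Order.TTheory GRing.Theory Num.Theory.
Import numFieldNormedType.Exports.

Local Open Scope classical_set_scope.
Local Open Scope ring_scope.

Definition edom {R : realType} {X : Type} (f : X -> \bar R) : set X :=
  [set u | (f u < +oo)%E].

Definition chi (R : realType) {X : Type} (D : set X) (u : X) : \bar R :=
  (if u \in D then 0 else +oo)%E.

(* The dual addition [+%dE] is the one with (-oo) + (+oo) = +oo. *)
Definition add_chi {R : realType} {X : Type} (f : X -> \bar R) (D : set X)
  (u : X) : \bar R := (f u + chi R D u)%dE.

Definition lsc_envelope {R : realType} {X : topologicalType} (f : X -> \bar R)
  (u : X) : \bar R :=
  ereal_sup [set ereal_inf (f @` U) | U in nbhs u].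

Section radial.
Context {R : realType} {X : lmodType R}.
Implicit Types (f : X -> \bar R) (D : set X).

Definition radial_delta f D (u0 : X) (a t : R) : \bar R :=
  ereal_sup [set ((f (t *: u + (1 - t) *: u0)%R - f u) /
                  (a%:E + `|f u|))%E | u in D].

(* Excluding t = 1 from the upper limit is immaterial: the quotients all vanish
   at t = 1 when f is finite on D. *)
Definition ru_usc f D (u0 : X) : Prop :=
  exists2 a : R, 0 < a & (limf_esup (radial_delta f D u0 a) 1^'- <= 0)%E.

Definition radial_extension f (u0 u : X) : \bar R :=
  limf_einf (fun t : R => f (t *: u + (1 - t) *: u0)) 1^'-.

End radial.

Definition strongly_star_shaped {R : realType} {X : topologicalLmodType R}
    (D : set X) (u0 : X) : Prop :=
  D u0 /\ forall t : R, 0 <= t < 1 ->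
    [set t *: u + (1 - t) *: u0 | u in closure D] `<=` D.

Lemma lte_between {R : realType} (x y : \bar R) : (x < y)%E ->
  exists2 r : R, (x < r%:E)%E & (r%:E < y)%E.
Proof.
case: x y => [a| |] [b| |]//=; rewrite ?lte_fin => ab.
- by exists ((a + b) / 2); rewrite lte_fin midf_lt.
- by exists (a + 1); rewrite ?ltry// lte_fin ltrDl.
- by exists (b - 1); rewrite ?ltNyr// lte_fin gtrBl.
- by exists 0; rewrite ?ltNyr ?ltry.
Qed.

Lemma limf_einf_at_left_seq {R : realType} (g : R -> \bar R) :
  limf_einf g 1^'- =
  ereal_inf [set limn_einf (g \o t) | t in
    [set t : R^nat | (forall n, 0 <= t n < 1) /\ t @ \oo --> (1 : R)]].
Proof.
apply/eqP; rewrite eq_le; apply/andP; split.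
  apply: le_ereal_inf_tmp => _ [t [t01 t1] <-].
  rewrite [leLHS]limf_einfE [leRHS](limf_einfE _ \oo).
  apply: ge_ereal_sup => _ [V V1 <-].
  apply: le_ereal_sup_tmp; exists (ereal_inf ((g \o t) @` (t @^-1` V))).
    exists (t @^-1` V) => //.
    have : \forall n \near \oo, t n < 1 -> V (t n) by exact: t1 V1.
    by apply: filterS => n; apply; case/andP: (t01 n).
  by apply: ereal_inf_le_tmp => _ [n Vn <-]; exists (t n).
rewrite leNgt; apply/negP => /lte_between[r Lr rM].
have below n : {t : R | [/\ 0 <= t < 1, 1 - n.+1%:R^-1 < t & (g t < r%:E)%E]}.
  apply: cid; pose V : set R := [set t | 0 <= t < 1 /\ 1 - n.+1%:R^-1 < t].
  have V1 : 1^'- V.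
    near=> t; split; last first.
      near: t; apply: nbhs_left_gt.
      by rewrite gtrBl invr_gt0 ltr0n.
    apply/andP; split; last by near: t; exact: nbhs_left_lt.
    by apply: ltW; near: t; exact: nbhs_left_gt.
  have : (ereal_inf (g @` V) < r%:E)%E.
    apply: le_lt_trans Lr; rewrite limf_einfE; apply: ereal_sup_ubound.
    by exists V.
  by move=> /ereal_inf_lt[_ [t [t01 nt] <-] gtr]; exists t; split.
pose t n := sval (below n).
have t01 n : 0 <= t n < 1 by rewrite /t; case: (below n) => ? [].
have tn n : 1 - n.+1%:R^-1 < t n by rewrite /t; case: (below n) => ? [].
have tr n : (g (t n) < r%:E)%E by rewrite /t; case: (below n) => ? [].
have t1 : t @ \oo --> (1 : R).
  apply: (@squeeze_cvgr _ _ _ _ (fun n => 1 - harmonic n) (cst 1)).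
  - near=> n; rewrite (ltW (tn n))/=; apply: ltW; by case/andP: (t01 n).
  - rewrite -[X in _ --> X]subr0; apply: cvgB; [exact: cvg_cst|exact: cvg_harmonic].
  - exact: cvg_cst.
suff : (limn_einf (g \o t) <= r%:E)%E.
  apply/negP; rewrite -ltNge; apply: lt_le_trans rM _.
  by apply: ereal_inf_lbound; exists t.
rewrite [leLHS](limf_einfE _ \oo); apply: ge_ereal_sup => _ [V [N _ NV] <-].
apply: ge_ereal_inf; exists (g (t N)); last exact/ltW/tr.
by exists N => //; apply: NV => /=.
Unshelve. all: by end_near. Qed.

Lemma radial_extensionE {R : realType} {X : lmodType R} (f : X -> \bar R)
    (u0 u : X) :
  radial_extension f u0 u =
  ereal_inf [set limn_einf (fun n => f (t n *: u + (1 - t n) *: u0)) | t in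
    [set t : R^nat | (forall n, 0 <= t n < 1) /\ t @ \oo --> (1 : R)]].
Proof. exact: limf_einf_at_left_seq. Qed.

(* Main.v *)
Require Import Defs.
From HB Require Import structures.
From mathcomp Require Import all_boot all_order all_algebra.
From mathcomp Require Import all_classical all_reals all_analysis.
From mathcomp Require Import ring lra.

Set Implicit Arguments.
Unset Strict Implicit.
Unset Printing Implicit Defensive.

Import Order.TTheory GRing.Theory Num.Theory.
Import numFieldNormedType.Exports.

Local Open Scope classical_set_scope.
Local Open Scope ring_scope.

(** Write T_t for the homothety u |-> t u + (1 - t) u0.  Since f is bounded
    below on D, |f| exceeds f there by at most a constant, so radial uniform
    upper semicontinuity amounts to an affine growth bound: for some b > 0 and
    every e > 0, if t < 1 is close enough to 1, then f u <= r implies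
    f (T_t u) <= r + e (b + r), uniformly in u in D ([ru_uscP]).  Everything
    comes from the way this bound propagates.

    If u is in the closure of D, then T_s u is in D for 0 <= s < 1, and
    T_t u = T_(t/s) (T_s u).  Choose s between t and 1 with f (T_s u) close to
    the lower limit that defines the radial extension at u.  The ratio t/s is
    closer to 1 than t, so the bound at T_s u yields
    f (T_t u) <= r + e (b + r) as soon as the radial extension at u is at most
    r ([radial_extension_growth]).  Hence the upper limit of f (T_t u) as t
    tends to 1 is at most the lower limit, which is the convergence in (ii).
    Moreover T_s (T_t u) = T_(st) u, so letting s tend to 1 gives the same
    growth bound for the radial extension itself
    ([radial_extension_self_growth]), that is, the second half of (ii).

    For (i), T_t u tends to u inside D, so the envelope at u is at most the
    radial extension.  Conversely, let the envelope at u be less than r.  Then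
    u is approached by points v of D with f v < r, and so T_t u is approached
    by the points T_t v, where f is at most r + e (b + r).  As T_t u belongs
    to D, where f is its own envelope, f (T_t u) <= r + e (b + r) as well; now
    let t tend to 1 and then e to 0 ([lsc_envelope_closure]). *)

(** * Upper and lower limits along a filter *)

Section limits_along_a_filter.
Context {T : choiceType} {X : filteredType T} {R : realType}.
Implicit Types (g h : X -> \bar R) (F : set_system X) (x : \bar R).

Lemma lt_limf_einf_near g F x : Filter F ->
  (x < limf_einf g F)%E -> \forall t \near F, (x < g t)%E.
Proof.
rewrite limf_einfE => FF /ereal_sup_gt[_ [V FV <-] xV].
apply: filterS FV => t Vt; apply: lt_le_trans xV _.
by apply: ereal_inf_lbound; exists t.
Qed.

Lemma limf_esup_lt_near g F x : Filter F ->
  (limf_esup g F < x)%E -> \forall t \near F, (g t < x)%E.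
Proof.
move=> FF /ereal_inf_lt[_ [V FV <-] Vx].
apply: filterS FV => t Vt; apply: le_lt_trans Vx.
by apply: ereal_sup_ubound; exists t.
Qed.

Lemma limf_einf_lt_frequently g F x (V : set X) :
  (limf_einf g F < x)%E -> F V -> exists2 t, V t & (g t < x)%E.
Proof.
rewrite limf_einfE => gx FV.
have : (ereal_inf (g @` V) < x)%E.
  by apply: le_lt_trans gx; apply: ereal_sup_ubound; exists V.
by move=> /ereal_inf_lt[_ [t Vt <-] gtx]; exists t.
Qed.

Lemma near_ge_limf_einf g F x :
  (\forall t \near F, (x <= g t)%E) -> (x <= limf_einf g F)%E.
Proof.
rewrite limf_einfE => Fx; apply: le_ereal_sup_tmp.
exists (ereal_inf (g @` [set t | (x <= g t)%E])).
  by exists [set t | (x <= g t)%E].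
by apply: le_ereal_inf_tmp => _ [t xt <-].
Qed.

Lemma near_limf_einf_le g h F : Filter F ->
  (\forall t \near F, (g t <= h t)%E) -> (limf_einf g F <= limf_einf h F)%E.
Proof.
move=> FF gh; rewrite limf_einfE; apply: ge_ereal_sup => _ [V FV <-].
apply: near_ge_limf_einf; apply: filterS (filterI FV gh) => t [Vt].
by apply: le_trans; apply: ereal_inf_lbound; exists t.
Qed.

Lemma near_le_limf_esup g F x :
  (\forall t \near F, (g t <= x)%E) -> (limf_esup g F <= x)%E.
Proof.
move=> Fx; apply: ge_ereal_inf.
exists (ereal_sup (g @` [set t | (g t <= x)%E])).
  by exists [set t | (g t <= x)%E].
by apply: ge_ereal_sup => _ [t xt <-].
Qed.

Lemma near_le_limf_einf g F x : ProperFilter F ->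
  (\forall t \near F, (g t <= x)%E) -> (limf_einf g F <= x)%E.
Proof.
move=> FF Fx; rewrite leNgt; apply/negP => /lt_limf_einf_near xF.
have [t [gx]] := filter_ex (filterI Fx xF).
by rewrite ltNge gx.
Qed.

Lemma limf_einf_esup_cvg g F (l : R) : Filter F ->
  (l%:E <= limf_einf g F)%E -> (limf_esup g F <= l%:E)%E ->
  g @ F --> l%:E.
Proof.
move=> FF lg gl A lA.
have /nbhs_ballP[d /= d0 dA] : nbhs (l : R) [set y | A y%:E] by [].
have lo : \forall t \near F, ((l - d)%:E < g t)%E.
  by apply: lt_limf_einf_near; apply: lt_le_trans lg; rewrite lte_fin gtrBl.
have hi : \forall t \near F, (g t < (l + d)%:E)%E.
  by apply: limf_esup_lt_near; apply: le_lt_trans gl _; rewrite lte_fin ltrDl.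
apply: filterS (filterI lo hi) => t [].
rewrite /preimage/=.
case: (g t) => [y| |]//; rewrite ?ltNge ?leey ?leNye // -!ltNge !lte_fin => ly yl.
apply: (dA y); rewrite /ball/= ltr_distlC; apply/andP; split; lra.
Qed.

End limits_along_a_filter.

Lemma at_left1_itv {R : realType} (P : set R) : (\forall t \near 1^'-, P t) ->
  exists2 c : R, 0 <= c < 1 & forall t, c < t < 1 -> P t.
Proof.
move=> [d /= d0 dP]; exists (Num.max 0 (1 - d)).
  by rewrite le_max lexx /= gt_max ltr01 gtrBl.
move=> t; rewrite gt_max => /andP[/andP[_ dt] t1]; apply: dP => //=.
by rewrite ltr_distlC; apply/andP; split; lra.
Qed.

Lemma near_at_left1 {R : realType} (c : R) : c < 1 ->
  \forall t \near 1^'-, c < t < 1.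
Proof.
move=> c1; near=> t; apply/andP; split; near: t.
  exact: nbhs_left_gt.
exact: nbhs_left_lt.
Unshelve. all: by end_near. Qed.

(** * Radial upper semicontinuity as a growth bound *)

Section growth.
Context {R : realType}.

Lemma growth_lt (b r d : R) : 0 < d ->
  exists2 e : R, 0 < e & r + e * (b + r) < r + d.
Proof.
move=> d0; exists (d / (`|b + r| + 1)); first by rewrite divr_gt0 // ltr_wpDl.
rewrite ltrD2l -mulrA gtr_pMr // mulrC ltr_pdivrMr ?ltr_wpDl // mul1r.
by rewrite (le_lt_trans (ler_norm _)) // ltrDl.
Qed.

Lemma le_growth_le (b r : R) (x : \bar R) :
  (forall e : R, 0 < e -> (x <= (r + e * (b + r))%:E)%E) -> (x <= r%:E)%E.
Proof.
move=> xb; apply/lee_addgt0Pr => d d0.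
have [e e0 eb] := growth_lt b r d0.
by apply: le_trans (xb e e0) _; rewrite -EFinD lee_fin ltW.
Qed.

(** Continuity from the right of s |-> s + e (b + s): it replaces strict upper
    bounds of a lower limit by the limit itself. *)
Lemma le_growth_right (b e r : R) (x : \bar R) : 0 < e ->
  (forall s : R, r < s -> (x <= (s + e * (b + s))%:E)%E) ->
  (x <= (r + e * (b + r))%:E)%E.
Proof.
move=> e0 xs; apply/lee_addgt0Pr => d d0.
have e1 : 0 < 1 + e by rewrite addr_gt0.
(* The map s |-> s + e (b + s) has slope 1 + e. *)
have := xs (r + d / (1 + e)); rewrite ltrDl divr_gt0 // => /(_ isT) /le_trans; apply.
rewrite -EFinD lee_fin le_eqVlt; apply/orP; left; apply/eqP.
by field; rewrite gt_eqF.
Qed.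

Lemma radial_quotient_le (a e x : R) (y : \bar R) : 0 < a ->
  ((y - x%:E) / (a%:E + `|x%:E|) <= e%:E)%E =
  (y <= (x + e * (a + `|x|))%:E)%E.
Proof.
move=> a0; have ax0 : 0 < a + `|x| by rewrite ltr_pwDl.
rewrite abse_EFin -EFinD inver gt_eqF // lee_pdivrMr // leeBlDr //.
by rewrite -EFinM -EFinD addrC.
Qed.

End growth.

Section radial_growth.
Context {R : realType} {X : lmodType R}.
Implicit Types (f g : X -> \bar R) (D : set X) (u : X) (a b e t : R).

Definition homothety u0 t u : X := t *: u + (1 - t) *: u0.

Lemma homothety_comp u0 s t u :
  homothety u0 s (homothety u0 t u) = homothety u0 (s * t) u.
Proof.
rewrite /homothety scalerDr !scalerA -addrA -scalerDl; congr (_ + _ *: _).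
by ring.
Qed.

(** Two functions are allowed so that the bound can be transported from f to
    its radial extension, first on one side and then on both.  The real r,
    rather than the value f u, keeps extended arithmetic out of the bound and
    makes it void where f u = +oo. *)
Definition radial_growth f g D u0 b e t : Prop :=
  forall u (r : R), D u -> (f u <= r%:E)%E ->
    (g (homothety u0 t u) <= (r + e * (b + r))%:E)%E.

(** The quotients in the definition of [ru_usc] involve a + |f u|, the growth
    bound involves b + r with f u <= r.  Above the lower bound m they are
    comparable: |x| <= x + 2 |m| whenever x >= m, whence b = a + 2 |m|; in the
    other direction b + f u <= b + |f u|. *)
Lemma ru_uscP f D u0 (m : R) :
    (forall u, D u -> (m%:E <= f u < +oo)%E) ->
  ru_usc f D u0 <->
  exists2 b : R, 0 < b & forall e, 0 < e ->
    \forall t \near 1^'-, radial_growth f f D u0 b e t.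
Proof.
move=> fD.
have fDE u : D u -> exists2 x : R, f u = x%:E & m <= x.
  move=> /fD; case: (f u) => [x| |]; rewrite ?ltxx ?andbF //.
  by rewrite lee_fin ltry andbT; exists x.
split => [[a a0 usc]|[b b0 fb]].
  exists (a + 2 * `|m|); first by rewrite ltr_pwDl // mulr_ge0.
  move=> e e0.
  have : (limf_esup (radial_delta f D u0 a) 1^'- < e%:E)%E.
    by apply: le_lt_trans usc _; rewrite lte_fin.
  move=> /limf_esup_lt_near; apply: filterS => t dte u r Du.
  have [x fu mx] := fDE u Du; rewrite fu lee_fin => xr.
  have : (f (homothety u0 t u) <= (x + e * (a + `|x|))%:E)%E.
    rewrite -radial_quotient_le // -fu; apply: le_trans (ltW dte).
    by apply: ereal_sup_ubound; exists u.
  move=> /le_trans; apply; rewrite lee_fin lerD // ler_wpM2l ?(ltW e0) //.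
  have xm : `|x| <= x + 2 * `|m|.
    have := normr_ge0 m; have := lerNnormlW (lexx `|m|).
    by rewrite ler_norml; lra.
  by rewrite -addrA lerD2l; lra.
exists b => //; apply/lee_addgt0Pr => e e0; rewrite add0e.
apply: near_le_limf_esup; apply: filterS (fb e e0) => t gt.
apply: ge_ereal_sup => _ [u Du <-].
have [x fu mx] := fDE u Du; rewrite fu radial_quotient_le //.
apply: le_trans (gt u x Du _) _; rewrite ?fu // lee_fin lerD2l.
by rewrite ler_wpM2l ?(ltW e0) // lerD2l ler_norm.
Qed.

End radial_growth.
(** * The radial extension on the closure *)

Section star_shaped.
Context {R : realType} {X : topologicalLmodType R}.
Implicit Types (f : X -> \bar R) (D : set X) (u : X) (b e t : R).

(** Joint continuity in the ratio and the point: both the limit as the ratio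
    tends to 1 and the continuity of a single homothety are instances. *)
Lemma homothety_cvg (T : Type) (F : set_system T) (FF : Filter F)
    (a : T -> R) (v : T -> X) u0 (l : R) u :
  a @ F --> l -> v @ F --> u ->
  homothety u0 (a i) (v i) @[i --> F] --> homothety u0 l u.
Proof.
have scale_cvg (c : T -> R) (w : T -> X) (k : R) (x : X) :
    c @ F --> k -> w @ F --> x ->
    c i *: w i @[i --> F] --> k *: x.
  apply: (@continuous2_cvg _ R^o X X _ FF c w (fun k x => k *: x) k x).
  exact: (@scale_continuous R X (k, x)).
move=> al vu; apply: (@continuous2_cvg _ X X X _ FF
  (fun i => a i *: v i)
  (fun i => (1 - a i) *: u0) (fun x y => x + y)
  (l *: u) ((1 - l) *: u0)).
- exact: (@add_continuous X (_, _)).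
- exact: scale_cvg.
- by apply: scale_cvg; [apply: cvgB => //; exact: cvg_cst | exact: cvg_cst].
Qed.

Lemma homothety_cvg1 u0 u : homothety u0 t u @[t --> (1 : R)^'-] --> u.
Proof.
rewrite -[X in _ --> X](_ : homothety u0 1 u = u); last first.
  by rewrite /homothety scale1r subrr scale0r addr0.
by apply: homothety_cvg; [exact: cvg_at_left_filter | exact: cvg_cst].
Qed.

Lemma homothety_star D u0 u t : strongly_star_shaped D u0 ->
  closure D u -> 0 <= t < 1 -> D (homothety u0 t u).
Proof. by move=> [_ star] Du t01; apply: (star t t01); exists u. Qed.

(** The bound at a point of D is applied to T_s u, which is in D although u
    need not be, for a parameter s in ]t, 1[ where f (T_s u) is close to the
    lower limit.  The remaining homothety has ratio t / s, which lies in
    ]t, 1[; this is why the bound is needed for all ratios above a common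
    threshold c. *)
Lemma radial_extension_growth f D u0 b e : strongly_star_shaped D u0 -> 0 < e ->
  (\forall t \near 1^'-, radial_growth f f D u0 b e t) ->
  \forall t \near 1^'-,
    radial_growth (radial_extension f u0) f (closure D) u0 b e t.
Proof.
move=> star e0 /at_left1_itv[c /andP[c0 c1] fc].
apply: filterS (near_at_left1 c1) => t /andP[ct t1] u r Du ur.
have t0 : 0 < t by exact: le_lt_trans ct.
apply: le_growth_right => // r' rr'.
have ur' : (radial_extension f u0 u < r'%:E)%E.
  by apply: le_lt_trans ur _; rewrite lte_fin.
have [s /andP[ts s1] fs] := limf_einf_lt_frequently ur' (near_at_left1 t1).
have s0 : 0 < s by exact: lt_trans ts.
have -> : homothety u0 t u = homothety u0 (t / s) (homothety u0 s u).
  by rewrite homothety_comp mulfVK // gt_eqF.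
apply: fc; last exact: ltW.
  rewrite ltr_pdivrMr // mul1r ts andbT; apply: lt_le_trans ct _.
  by rewrite ler_pdivlMr // ler_piMr // ltW.
by apply: (homothety_star star Du); rewrite s1 ltW.
Qed.

(** Apply the bound at ratio s t and let s tend to 1; s t stays above the
    threshold c once s > c / t. *)
Lemma radial_extension_self_growth f D u0 b e :
  (\forall t \near 1^'-,
    radial_growth (radial_extension f u0) f (closure D) u0 b e t) ->
  \forall t \near 1^'-,
    radial_growth (radial_extension f u0) (radial_extension f u0)
      (closure D) u0 b e t.
Proof.
move=> /at_left1_itv[c /andP[c0 c1] fc].
apply: filterS (near_at_left1 c1) => t /andP[ct t1] u r Du ur.
have t0 : 0 < t by exact: le_lt_trans ct.
apply: near_le_limf_einf.
have : c / t < 1 by rewrite ltr_pdivrMr // mul1r.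
move=> /near_at_left1; apply: filterS => s /andP[cs s1].
have := @homothety_comp R X u0 s t u; rewrite /homothety => ->; apply: fc => //.
rewrite -ltr_pdivrMr // cs /= (lt_trans _ t1) //.
by rewrite gtr_pMl.
Qed.

Lemma radial_extension_ge f D u0 (m : R) u : strongly_star_shaped D u0 ->
  (forall v, D v -> (m%:E <= f v)%E) -> closure D u ->
  (m%:E <= radial_extension f u0 u)%E.
Proof.
move=> star fm Du; apply: near_ge_limf_einf.
apply: filterS (near_at_left1 (@ltr01 R)) => t /andP[t0 t1].
by apply/fm/(homothety_star star Du); rewrite t1 ltW.
Qed.

(** The radial extension is by definition the lower limit of f (T_t u), and
    the growth bound makes it an upper bound of the upper limit. *)
Lemma radial_extension_cvg f D u0 b u :
  (forall e, 0 < e -> \forall t \near 1^'-,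
    radial_growth (radial_extension f u0) f (closure D) u0 b e t) ->
  closure D u -> (-oo < radial_extension f u0 u)%E ->
  f (homothety u0 t u) @[t --> (1 : R)^'-] --> radial_extension f u0 u.
Proof.
move=> fb Du; case E : (radial_extension f u0 u) => [l| |] // _; last first.
  apply/cvgeyPgt => A; apply: lt_limf_einf_near.
  by move: E; rewrite /radial_extension => ->; rewrite ltry.
apply: limf_einf_esup_cvg; first by move: E; rewrite /radial_extension => ->.
apply: le_growth_le (b) _ _ _ => e e0; apply: near_le_limf_esup.
by apply: filterS (fb e e0) => t; apply => //; rewrite E.
Qed.

(** * The lower semicontinuous envelope *)

Lemma lsc_envelope_le_limf (F : X -> \bar R) (T : choiceType)
    (S : filteredType T) (G : set_system S) (phi : S -> X) u : Filter G ->
  phi @ G --> u -> (lsc_envelope F u <= limf_einf (F \o phi) G)%E.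
Proof.
move=> FG phiu; apply: ge_ereal_sup => _ [U Uu <-].
have GU : G (phi @^-1` U) by exact: phiu.
apply: near_ge_limf_einf; apply: filterS GU => t Ut.
by apply: ereal_inf_lbound; exists (phi t).
Qed.

Lemma lsc_envelope_lt_frequently (F : X -> \bar R) u (x : \bar R) U :
  (lsc_envelope F u < x)%E -> nbhs u U -> exists2 v, U v & (F v < x)%E.
Proof.
move=> Fx Uu; have : (ereal_inf (F @` U) < x)%E.
  by apply: le_lt_trans Fx; apply: ereal_sup_ubound; exists U.
by move=> /ereal_inf_lt[_ [v Uv <-] Fv]; exists v.
Qed.

Lemma lsc_envelope_le (F : X -> \bar R) u (x : \bar R) :
  (forall U, nbhs u U -> exists2 v, U v & (F v <= x)%E) ->
  (lsc_envelope F u <= x)%E.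
Proof.
move=> Fx; apply: ge_ereal_sup => _ [U /Fx[v Uv vx] <-].
by apply: le_trans vx; apply: ereal_inf_lbound; exists v.
Qed.

Lemma add_chi_in f D u : D u -> add_chi f D u = f u.
Proof.
by move=> Du; rewrite /add_chi /chi mem_set //
  DualAddTheoryNumDomain.dadde0.
Qed.

Lemma add_chi_out f D u : ~ D u -> add_chi f D u = +oo%E.
Proof.
by move=> Du; rewrite /add_chi /chi memNset //
  DualAddTheoryNumDomain.daddey.
Qed.

(** The complement of the closure contains a whole neighbourhood on which
    the indicator is infinite. *)
Lemma lsc_envelope_out f D u : ~ closure D u ->
  lsc_envelope (add_chi f D) u = +oo%E.
Proof.
move=> Du; have [U Uu UD] : exists2 U, nbhs u U & ~ (D `&` U !=set0).
  apply: contrapT => H; apply: Du => U Uu; apply: contrapT => UD.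
  by apply: H; exists U.
apply/eqP; rewrite -leye_eq; apply: le_ereal_sup_tmp.
exists (ereal_inf (add_chi f D @` U)); first by exists U.
apply: le_ereal_inf_tmp => _ [v Uv <-]; rewrite add_chi_out // => Dv.
by apply: UD; exists v.
Qed.

(** The growth bound passes to the envelope through the continuity of T_t,
    which turns points v near u with small values into points T_t v near T_t u
    with values under control.  The hypothesis that f is its own envelope is
    used at T_t u only, which is in D even when u is not. *)
Lemma lsc_envelope_closure f D u0 b u : strongly_star_shaped D u0 ->
  (forall v, D v -> lsc_envelope (add_chi f D) v = f v) ->
  (forall e, 0 < e -> \forall t \near 1^'-, radial_growth f f D u0 b e t) ->
  closure D u ->
  lsc_envelope (add_chi f D) u = radial_extension f u0 u.
Proof.
move=> star flsc fb Du; apply/eqP; rewrite eq_le; apply/andP; split.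
  apply: (@le_trans _ _
    (limf_einf (fun t : R => add_chi f D (homothety u0 t u)) 1^'-)).
    by apply: lsc_envelope_le_limf; exact: homothety_cvg1.
  apply: near_limf_einf_le; apply: filterS (near_at_left1 (@ltr01 R)).
  move=> t /andP[t0 t1]; rewrite add_chi_in //.
  by apply: (homothety_star star Du); rewrite t1 ltW.
rewrite leNgt; apply/negP => /lte_between[r ur rf].
have : (radial_extension f u0 u <= r%:E)%E; last by rewrite leNgt rf.
apply: le_growth_le (b) _ _ _ => e e0; apply: near_le_limf_einf.
have t01 := near_at_left1 (@ltr01 R).
apply: filterS (filterI t01 (fb e e0)) => t [/andP[t0 t1] ft].
have {}t01 : 0 <= t < 1 by rewrite t1 ltW.
rewrite -[leLHS]flsc; last exact: homothety_star star Du t01.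
apply: lsc_envelope_le => V tuV.
have Vu : nbhs u [set v | V (homothety u0 t v)].
  have tu : homothety u0 t v @[v --> u] --> homothety u0 t u.
    by apply: homothety_cvg; [exact: cvg_cst | exact: cvg_id].
  exact: tu tuV.
have [v Vv vr] := lsc_envelope_lt_frequently ur Vu.
have Dv : D v by apply: contrapT => /(add_chi_out f) E; move: vr; rewrite E.
exists (homothety u0 t v) => //.
rewrite add_chi_in; last exact: homothety_star star (subset_closure Dv) t01.
by apply: ft => //; move: vr; rewrite add_chi_in // => /ltW.
Qed.

End star_shaped.
Theorem theorem3p1 (R : realType) (X : topologicalLmodType R)
    (hX : hausdorff_space X) (f : X -> \bar R)
    (hf : forall u, (-oo < f u)%E)
    (D : set X) (hD : D `<=` edom f) (u0 : X) (hu0 : D u0)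
    (hstar : strongly_star_shaped D u0)
    (husc : ru_usc f D u0)
    (hinf : (-oo < ereal_inf (f @` D))%E) :
  ((forall u, D u -> lsc_envelope (add_chi f D) u = f u) ->
    forall u, lsc_envelope (add_chi f D) u =
              add_chi (radial_extension f u0) (closure D) u)
  /\
  ((forall u, closure D u ->
      f (t *: u + (1 - t) *: u0) @[t --> (1 : R)^'-] -->
        radial_extension f u0 u)
   /\
   ru_usc (radial_extension f u0)
     (closure D `&` edom (radial_extension f u0)) u0).
Proof.
have [m _ minf] := lte_between hinf.
have fm u : D u -> (m%:E <= f u)%E.
  by move=> Du; apply: le_trans (ltW minf) _; apply: ereal_inf_lbound; exists u.
have fmy u : D u -> (m%:E <= f u < +oo)%E by move=> Du; rewrite fm // hD.
have /(ru_uscP u0 fmy)[b b0 fb] := husc.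
have hatb e : 0 < e -> \forall t \near 1^'-,
    radial_growth (radial_extension f u0) f (closure D) u0 b e t.
  by move=> e0; apply: radial_extension_growth => //; exact: fb.
have hatm u : closure D u -> (m%:E <= radial_extension f u0 u)%E.
  exact: radial_extension_ge.
split.
  move=> flsc u; have [Du|Du] := pselect (closure D u).
    by rewrite add_chi_in //; exact: (lsc_envelope_closure hstar flsc fb Du).
  by rewrite add_chi_out // lsc_envelope_out.
split.
  move=> u Du; apply: (radial_extension_cvg hatb Du).
  by apply: lt_le_trans (hatm u Du); rewrite ltNyr.
apply: (iffRL (ru_uscP u0 (m := m) _)) => [u [Du uy]|]; first by rewrite hatm.
exists b => // e e0.
apply: filterS (radial_extension_self_growth (hatb e e0)) => t gt u r [Du _].
exact: gt.
Qed.
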